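(* Let $(Z,\rho)$ be a (possibly extended) metric space with at least three points and let $M$ be the Möbius structure induced by $\rho$. The following are equivalent: 1) $(Z,M)$ is complete as a (strong) Möbius space. 2) $(Z,\rho)$ is complete as a metric space and is either bounded or has a point at infinity.
   Context: Semi-metrics. A semi-metric on $Z$ is a symmetric map $\rho:Z\times Z\to[0,\infty)$ with $\rho(z,z')=0$ iff $z=z'$. It is a $K$-quasi-metric ($K\ge1$) if $\rho(x,z)\le K\max(\rho(x,y),\rho(y,z))$ for all $x,y,z$; a quasi-metric if this holds for some $K$. An extended metric (resp. semi-metric, $K$-quasi-metric) is a map $\rho:Z\times Z\to[0,\infty]$ for which there is exactly one point $\omega\in Z$ (the point at infinity) with $\rho(x,\omega)=\rho(\omega,x)=\infty$ for all $x\neq\omega$, $\rho(\omega,\omega)=0$, and whose restriction to $Z\setminus\{\omega\}$ is a (finite-valued) metric (resp. semi-metric, $K$-quasi-metric). ''Possibly extended'' means either case is allowed. Completeness of an extended metric space as a metric space means that Cauchy sequences with respect to $\rho$ converge, i.e. that the metric space $Z\setminus\{\omega\}$ is complete. ''Bounded'' means $\sup\rho<\infty$. Cross ratios. A quadruple in $Z^4$ is admissible if no three of its entries (at distinct positions) coincide; $\mathcal{A}$ is the set of admissible quadruples. A tuple is non-degenerate if its entries are pairwise distinct. A (possibly extended) semi-metric $\rho$ induces on $\mathcal{A}$ the cross ratio $cr(z_1,z_2,z_3,z_4)=\frac{\rho(z_1,z_2)\rho(z_3,z_4)}{\rho(z_1,z_3)\rho(z_2,z_4)}\in[0,\infty]$,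 where infinite distances cancel each other (e.g. $cr(z_1,z_2,z_3,\omega)=\rho(z_1,z_2)/\rho(z_1,z_3)$, $cr(z_1,z_2,\omega,\omega)=0$, $cr(z_1,\omega,\omega,z_2)=1$ for $z_i\neq\omega$), and the Möbius structure $M=(a,b,c)$, $$M(z_1,z_2,z_3,z_4)=\big(\ln cr(z_1,z_3,z_4,z_2),\ \ln cr(z_1,z_4,z_2,z_3),\ \ln cr(z_1,z_2,z_3,z_4)\big),$$ with $\ln0=-\infty$, $\ln\infty=\infty$. A Möbius structure induced by a (possibly extended) metric is a strong Möbius structure, meaning it is induced by a quasi-metric. Möbius topology. For a non-degenerate triple $A=(\omega',\alpha,\beta)$ in $Z$ put $\rho_A(x,x)=0$ and, for $x\ne y$, $\rho_A(x,y)=e^{a(\alpha,x,\omega',\beta)+a(\alpha,\omega',y,\beta)-a(\alpha,x,y,\beta)}$ if $x\neq\beta,\ y\neq\alpha$, and $\rho_A(x,y)=e^{b(\alpha,x,y,\beta)-b(\alpha,x,\omega',\beta)-b(\alpha,\omega',y,\beta)}$ if $x\neq\alpha,\ y\neq\beta$ (the formulas agree where both apply; $e^\infty=\infty$). The topology $\mathcal{T}_M$ has as subbasis all sets $B_{A,r}(y)=\{x\in Z\mid\rho_A(x,y)<r\}$, over all non-degenerate triples $A=(\omega',\alpha,\beta)$, $r>0$, $y\in Z\setminus\{\omega'\}$. Cauchy sequences. Let $\sigma$ be a possibly extended quasi-metric inducing $M$. A good pair (with respect to $\sigma$) for a sequence $(x_n)$ in $Z$ is a pair $y\neq z$ of points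 of $Z$, neither being the point at infinity of $\sigma$ (if there is one), such that neither $\sigma(x_n,y)$ nor $\sigma(x_n,z)$ converges to $0$. The sequence $(x_n)$ is a Cauchy sequence in $(Z,M)$ if for one (and hence all) such good pairs $y,z$ one has $c(x_n,x_m,y,z)\to-\infty$ as $n,m\to\infty$ (i.e. for every $R$ there is $N$ such that for all $n,m\ge N$ the quadruple is admissible and $c(x_n,x_m,y,z)<-R$); the choice of $\sigma$ is immaterial, and ''one'' means for some such $\sigma$ and some good pair. $(Z,M)$ is complete if every Cauchy sequence in $(Z,M)$ converges with respect to $\mathcal{T}_M$. *)

(* Defs.v *)
(* MathComp-Analysis *)
From HB Require Import structures.
From mathcomp Require Import all_boot all_order all_algebra.
From mathcomp Require Import all_classical all_reals all_analysis.
Set Implicit Arguments.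
Unset Strict Implicit.
Unset Printing Implicit Defensive.
Import Order.TTheory GRing.Theory Num.Theory.
Import numFieldNormedType.Exports.
Local Open Scope classical_set_scope.
Local Open Scope ring_scope.
Local Open Scope ereal_scope.

Section distances.
Context {R : realType} {Z : choiceType}.
Implicit Types (rho : Z -> Z -> \bar R) (D : set Z).

Definition semi_metric_on D rho :=
  forall x y, D x -> D y ->
    [/\ rho x y \is a fin_num, 0 <= rho x y, rho x y = rho y x
      & rho x y = 0 <-> x = y].

Definition metric_on D rho :=
  semi_metric_on D rho /\
  forall x y z, D x -> D y -> D z -> rho x z <= rho x y + rho y z.

Definition quasi_metric_on D rho :=
  semi_metric_on D rho /\
  exists2 K : R, (1 <= K)%R &
    forall x y z, D x -> D y -> D z ->
      rho x z <= K%:E * maxe (rho x y) (rho y z).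

Definition is_infinity rho (w : Z) :=
  rho w w = 0 /\ forall x, x <> w -> rho x w = +oo /\ rho w x = +oo.

Definition extended (P : set Z -> (Z -> Z -> \bar R) -> Prop) rho :=
  exists w, unique (is_infinity rho) w /\ P (~` [set w]) rho.

Definition possibly_extended (P : set Z -> (Z -> Z -> \bar R) -> Prop) rho :=
  P setT rho \/ extended P rho.

Definition has_infinity rho := exists w, is_infinity rho w.

Definition bounded_distance rho :=
  ereal_sup (range (fun p : Z * Z => rho p.1 p.2)) < +oo.

Definition metric_cauchy rho (u : nat -> Z) :=
  forall e : R, (0 < e)%R -> exists N, forall n m,
    (N <= n)%N -> (N <= m)%N -> rho (u n) (u m) < e%:E.

(* In the extended case a Cauchy sequence is eventually constant equal to the
   point at infinity or eventually at finite distance from itself; in the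
   latter case a limit cannot be the point at infinity. *)
Definition metric_complete rho :=
  forall u : nat -> Z, metric_cauchy rho u ->
    exists z, rho (u n) z @[n --> \oo] --> (0 : \bar R).

End distances.

Section cross_ratio.
Context {R : realType} {Z : choiceType}.
Implicit Types (rho : Z -> Z -> \bar R) (z : Z).

Definition admissible z1 z2 z3 z4 :=
  [&& ~~ [&& z1 == z2 & z2 == z3], ~~ [&& z1 == z2 & z2 == z4],
      ~~ [&& z1 == z3 & z3 == z4] & ~~ [&& z2 == z3 & z3 == z4]].

Definition cancel_oo (x : \bar R) : \bar R := if x == +oo then 1 else x.

(* On an admissible quadruple the numerator and the denominator contain the
   same number of infinite factors, unless the point at infinity [w] fills both
   slots of one factor, which is then [rho w w = 0]. Replacing infinite factors
   by 1 therefore implements their cancellation in all cases; see the three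
   lemmas below. Recall that [0^-1 = +oo] in [\bar R]; on an admissible
   quadruple numerator and denominator do not vanish simultaneously. *)
Definition cross_ratio rho z1 z2 z3 z4 : \bar R :=
  (cancel_oo (rho z1 z2) * cancel_oo (rho z3 z4)) /
  (cancel_oo (rho z1 z3) * cancel_oo (rho z2 z4)).

Lemma cross_ratio_w4 rho w z1 z2 z3 : is_infinity rho w ->
  z2 <> w -> z3 <> w -> rho z1 z2 != +oo -> rho z1 z3 != +oo ->
  cross_ratio rho z1 z2 z3 w = rho z1 z2 / rho z1 z3.
Proof.
move=> [_ ww] /ww[z2w _] /ww[z3w _] /negbTE f2 /negbTE f3.
by rewrite /cross_ratio /cancel_oo z2w z3w f2 f3 eqxx /= !mule1.
Qed.

Lemma cross_ratio_w34 rho w z1 z2 : is_infinity rho w ->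
  z1 <> w -> z2 <> w -> cross_ratio rho z1 z2 w w = 0.
Proof.
move=> [w0 ww] /ww[z1w _] /ww[z2w _].
by rewrite /cross_ratio /cancel_oo z1w z2w eqxx w0 /= mule0 mul0e.
Qed.

Lemma cross_ratio_w23 rho w z1 z2 : is_infinity rho w ->
  z1 <> w -> z2 <> w -> cross_ratio rho z1 w w z2 = 1.
Proof.
move=> [_ ww] /ww[z1w _] /ww[_ wz2].
by rewrite /cross_ratio /cancel_oo z1w wz2 eqxx /= !mule1 inve1 mule1.
Qed.

End cross_ratio.

(* Only the values on admissible quadruples are meaningful. *)
Definition mobius_structure (R : realType) (Z : choiceType) :=
  Z -> Z -> Z -> Z -> \bar R * \bar R * \bar R.

Section mobius.
Context {R : realType} {Z : choiceType}.
Implicit Types (rho : Z -> Z -> \bar R) (M : mobius_structure R Z).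

Definition mobius_a M z1 z2 z3 z4 := (M z1 z2 z3 z4).1.1.
Definition mobius_b M z1 z2 z3 z4 := (M z1 z2 z3 z4).1.2.
Definition mobius_c M z1 z2 z3 z4 := (M z1 z2 z3 z4).2.

Definition mobius_of rho : mobius_structure R Z := fun z1 z2 z3 z4 =>
  (lne (cross_ratio rho z1 z3 z4 z2),
   lne (cross_ratio rho z1 z4 z2 z3),
   lne (cross_ratio rho z1 z2 z3 z4)).

Definition induces rho M :=
  forall z1 z2 z3 z4, admissible z1 z2 z3 z4 ->
    M z1 z2 z3 z4 = mobius_of rho z1 z2 z3 z4.

(* For [x != y] at least one of the two formulas applies, and all quadruples
   occurring in the selected formula are admissible. When [M] is induced by a
   semi-metric, the sums never involve opposite infinities. *)
Definition mobius_dist M (w al be x y : Z) : \bar R :=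
  if x == y then 0
  else if (x != be) && (y != al) then
    expeR (mobius_a M al x w be + mobius_a M al w y be - mobius_a M al x y be)
  else
    expeR (mobius_b M al x y be - mobius_b M al x w be - mobius_b M al w y be).

Definition mobius_subbase M : set (set Z) :=
  [set B | exists w al be (r : R) y,
    [/\ uniq [:: w; al; be], (0 < r)%R, y <> w
      & B = [set x | mobius_dist M w al be x y < r%:E]]].

End mobius.

Definition mobius_space (R : realType) (Z : choiceType)
  (M : mobius_structure R Z) : Type := Z.

HB.instance Definition _ (R : realType) (Z : choiceType)
  (M : mobius_structure R Z) := Choice.on (mobius_space M).
HB.instance Definition _ (R : realType) (Z : choiceType)
  (M : mobius_structure R Z) :=
  isSubBaseTopological.Build (mobius_space M) (mobius_subbase M) id.

Section mobius_complete.
Context {R : realType} {Z : choiceType}.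
Implicit Types (sigma : Z -> Z -> \bar R) (M : mobius_structure R Z).

Definition good_pair sigma (x : nat -> Z) (y z : Z) :=
  [/\ y <> z, ~ is_infinity sigma y, ~ is_infinity sigma z,
      ~ (sigma (x n) y @[n --> \oo] --> (0 : \bar R))
    & ~ (sigma (x n) z @[n --> \oo] --> (0 : \bar R))].

Definition mobius_cauchy M (x : nat -> Z) :=
  exists sigma, [/\ possibly_extended quasi_metric_on sigma, induces sigma M &
    exists y z, good_pair sigma x y z /\
      forall r : R, exists N, forall n m, (N <= n)%N -> (N <= m)%N ->
        admissible (x n) (x m) y z /\ mobius_c M (x n) (x m) y z < (- r)%:E].

Definition mobius_complete M :=
  forall x : nat -> mobius_space M, mobius_cauchy M x ->
    exists z : mobius_space M, x n @[n --> \oo] --> z.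

End mobius_complete.

(* Main.v *)
Require Import Defs.
From mathcomp Require Import all_boot all_order all_algebra.
From mathcomp Require Import all_classical all_reals all_analysis.
From mathcomp Require Import lra ring.

(** Write [d x y] for [rho x y] with infinite distances replaced by [1]
    ([reduced_dist]). This is a real-valued symmetric function on all of [Z],
    positive off the diagonal, and cross ratios of [rho] are ordinary quotients
    of values of [d]. In terms of [d] the objects of the theorem become
    elementary.

    - The inequality [rho_A(x, y) < r] for [A = (w, al, be)] reads
      [k * d x y < r * (d x w * d y w)], with
      [k = d al w * d be w / d al be] ([mobius_dist_lt]).
      Hence [x n] tends to [w] in the Moebius topology as soon as
      [d (x n) u / s n] tends to [d w u] for all [u], for some normalization
      [s n > 0] ([mobius_cvg_scaled]); conversely such a convergence forces
      [d (x n) w / d (x n) w'] to tend to [0] for every [w' <> w]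
      ([mobius_cvg_lt]).
    - A Cauchy sequence of the Moebius space satisfies
      [d (x n) (x m) = o(d (x n) y * d (x m) z)] for some [y <> z]
      ([cross_cauchy]); this no longer refers to the auxiliary quasi-metric of
      the definition.

    Suppose that [rho] is complete, and bounded or extended, and let [x]
    satisfy this estimate, where [z] is not the point at infinity (one of [y],
    [z] is not, and the estimate is symmetric). If [d (x n) z] does not exceed
    some bound at infinitely many finite points [x n], then the estimate and the
    triangle inequality bound [d (x m) z] and [d (x m) y] for all large [m];
    thus [x] is a Cauchy sequence of [rho], and its limit is a Moebius limit
    (take [s n = 1]). Otherwise [x n] leaves every bounded set, which excludes
    that [rho] is bounded, and [x] tends to the point at infinity (take
    [s n = d (x n) z]). This is [complete_mobius_complete].

    Conversely suppose that the Moebius space is complete. A Cauchy sequence of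
    [rho] without limit has distances to each point bounded above and bounded
    away from [0]; it is therefore Cauchy in the Moebius space, and its limit [w]
    contradicts the lower bound for [d (x n) w]. If [rho] is unbounded without a
    point at infinity, a sequence whose distances to every point tend to
    infinity is Cauchy in the Moebius space, while
    [d (x n) w / d (x n) w'] tends to [1] for all [w] and [w'], so it has no
    limit. *)

Set Implicit Arguments.
Unset Strict Implicit.
Unset Printing Implicit Defensive.
Import Order.TTheory GRing.Theory Num.Theory.
Import numFieldNormedType.Exports.
Local Open Scope classical_set_scope.
Local Open Scope ring_scope.

(** * Extended reals and admissible quadruples *)

Lemma cvge0P (R : realType) (f : nat -> \bar R) : (forall n, 0 <= f n)%E ->
  (f n @[n --> \oo] --> (0 : \bar R)) <->
  (forall e : R, 0 < e -> \forall n \near \oo, (f n < e%:E)%E).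
Proof.
move=> f0; split=> [cf e e0|H].
  have : nbhs (0%E : \bar R) [set x | (x < e%:E)%E].
    apply: open_nbhs_nbhs; split; last by rewrite /= lte_fin.
    exact: open_ereal_lt_ereal.
  by move/cf.
apply/fine_cvgP; split.
  near=> n; rewrite ge0_fin_numE//.
  apply: (@lt_trans _ _ (1%:E : \bar R)%E); last by rewrite ltry.
  by near: n; apply: H; exact: ltr01.
apply: (proj2 (cvgr0Pnorm_lt _)) => e e0; near=> n.
have fe : (f n < e%:E)%E by near: n; exact: H.
rewrite /= ger0_norm ?fine_ge0//.
by move: fe (f0 n); case: (f n) => [r| |]//=; rewrite lte_fin.
Unshelve. all: by end_near. Qed.

Lemma lne_lt_EFin (R : realType) (a r : R) : 0 <= a ->
  (lne a%:E < r%:E)%E = (a < expR r).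
Proof. by move=> a0; rewrite -lte_expeR lneK// in_itv /= lee_fin a0 leey. Qed.

Lemma expeR_lneDB (R : realType) (p q s : R) : 0 < p -> 0 < q -> 0 < s ->
  expeR (lne p%:E + lne q%:E - lne s%:E)%E = (p * q / s)%:E.
Proof.
move=> p0 q0 s0; rewrite !lne_EFin// -EFinD /= expRB expRD.
by rewrite !lnK// posrE.
Qed.

Lemma expeR_lneBB (R : realType) (p q s : R) : 0 < p -> 0 < q -> 0 < s ->
  expeR (lne p%:E - lne q%:E - lne s%:E)%E = (p / q / s)%:E.
Proof.
move=> p0 q0 s0; rewrite !lne_EFin// -EFinB /= !expRB.
by rewrite !lnK// posrE.
Qed.

(** A coincidence of three entries meets each of the three ways of splitting
    the quadruple into two pairs, that is, one of the two pairs coincides. *)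
Lemma admissible_pairs (Z : choiceType) (z1 z2 z3 z4 : Z) :
  [\/ z1 <> z2 /\ z3 <> z4, z1 <> z3 /\ z2 <> z4 | z1 <> z4 /\ z2 <> z3] ->
  admissible z1 z2 z3 z4.
Proof.
move=> h; apply/and4P.
by split; apply/negP => /andP[/eqP e1 /eqP e2]; subst; case: h => -[].
Qed.

(** * The reduced distance *)

Section reduced.
Context {R : realType} {Z : choiceType}.
Implicit Types (rho : Z -> Z -> \bar R).

(** The distance with the value [+oo] replaced by [1]. Infinite distances cancel
    in cross ratios, so this real-valued function determines them; at the point
    at infinity [w] it is [d w w = 0] and [d x w = 1] for [x <> w]. *)
Definition reduced_dist rho (x y : Z) : R := fine (cancel_oo (rho x y)).

Context (rho : Z -> Z -> \bar R) (hrho : possibly_extended metric_on rho).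
Local Notation d := (reduced_dist rho).
Local Notation W := (is_infinity rho).

Lemma infinity_unique x y : W x -> W y -> x = y.
Proof.
case: hrho => [[h _]|[w [[Ww uw] _]]] Wx Wy; last first.
  by rewrite -(uw _ Wx) -(uw _ Wy).
have [//|/eqP yx] := eqVneq x y; have [] := h x y I I.
by have [-> _] := Wy.2 _ yx.
Qed.

Lemma metric_off_infinity : metric_on (~` W) rho.
Proof.
case: hrho => [[h t]|[w [[Ww uw] [h t]]]].
  by split=> [x y _ _|x y z _ _ _]; [exact: h|exact: t].
have off x : ~ W x -> ~ x = w by move=> nW xw; apply: nW; rewrite xw.
by split=> [x y /off ? /off ?|x y z /off ? /off ? /off ?]; [exact: h|exact: t].
Qed.

Lemma dist_infty x y : W x \/ W y -> x <> y -> rho x y = +oo%E.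
Proof.
by move=> [Wx|Wy] xy; [have [] := Wx.2 y (nesym xy)|have [] := Wy.2 x xy].
Qed.

Lemma dist_off_infinity x y : ~ W x -> ~ W y -> rho x y = (d x y)%:E.
Proof.
move=> nx ny; have [+ _ _ _] := metric_off_infinity.1 _ _ nx ny.
by rewrite /reduced_dist /cancel_oo; case: (rho x y).
Qed.

Lemma dist_self x : rho x x = 0%E.
Proof.
have [Wx|nx] := pselect (W x); first exact: Wx.1.
by have [_ _ _ [_ ->]] := metric_off_infinity.1 _ _ nx nx.
Qed.

Lemma dist_cases x y :
  [\/ x = y, [/\ x <> y, W x \/ W y & rho x y = +oo%E]
    | [/\ x <> y, ~ W x & ~ W y] ].
Proof.
have [->|/eqP xy] := eqVneq x y; first exact: Or31.
have [WW|nWW] := pselect (W x \/ W y).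
  by apply: Or32; split=> //; exact: dist_infty.
by apply: Or33; split=> // WW; apply: nWW; [left|right].
Qed.

Lemma reduced_infty x y : W x \/ W y -> x <> y -> d x y = 1.
Proof.
by move=> WW /(dist_infty WW); rewrite /reduced_dist /cancel_oo => ->.
Qed.

Lemma cancel_dist x y : cancel_oo (rho x y) = (d x y)%:E.
Proof.
case: (dist_cases x y) => [->|[xy WW E]|[xy nx ny]].
- by rewrite /reduced_dist dist_self.
- by rewrite reduced_infty// /cancel_oo E.
- by rewrite dist_off_infinity// /cancel_oo.
Qed.

Lemma reduced_self x : d x x = 0.
Proof. by rewrite /reduced_dist dist_self /cancel_oo. Qed.

Lemma reduced_gt0 x y : x <> y -> 0 < d x y.
Proof.
case: (dist_cases x y) => [//|[xy WW E]|[xy nx ny]] _.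
  by rewrite reduced_infty.
have [_ + _] := metric_off_infinity.1 _ _ nx ny.
rewrite dist_off_infinity// lee_fin => d0 [de _].
rewrite lt_neqAle d0 andbT eq_sym; apply/eqP => E; apply: xy.
by apply: de; rewrite E.
Qed.

Lemma reduced_ge0 x y : 0 <= d x y.
Proof.
have [->|/eqP/reduced_gt0/ltW//] := eqVneq x y; by rewrite reduced_self.
Qed.

Lemma reducedC x y : d x y = d y x.
Proof.
case: (dist_cases x y) => [->//|[xy WW E]|[xy nx ny]].
  by rewrite !reduced_infty //; [case: WW; [right|left]|exact: nesym].
have [_ _ + _] := metric_off_infinity.1 _ _ nx ny.
by rewrite !dist_off_infinity// => -[].
Qed.

Lemma dist_ge0 x y : (0 <= rho x y)%E.
Proof.
case: (dist_cases x y) => [->|[xy WW ->//]|[xy nx ny]].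
  by rewrite dist_self.
by rewrite dist_off_infinity// lee_fin reduced_ge0.
Qed.

Lemma reduced_triangle y x z : ~ W x -> ~ W y -> ~ W z ->
  d x z <= d x y + d y z.
Proof.
move=> nx ny nz; have := metric_off_infinity.2 _ _ _ nx ny nz.
by rewrite !dist_off_infinity// lee_fin.
Qed.

Lemma reduced_lt_dist x y : d x y < 1 -> rho x y = (d x y)%:E.
Proof.
case: (dist_cases x y) => [->|[xy WW _]|[xy nx ny] _].
- by rewrite dist_self reduced_self.
- by rewrite reduced_infty// ltxx.
- by rewrite dist_off_infinity.
Qed.

Lemma dist_fin x y : (rho x y < +oo)%E -> rho x y = (d x y)%:E.
Proof.
case: (dist_cases x y) => [->|[xy WW ->]|[xy nx ny] _].
- by rewrite dist_self reduced_self.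
- by rewrite ltxx.
- by rewrite dist_off_infinity.
Qed.

(** The hypothesis puts [x] and [y] either both at infinity, hence equal, or both
    at finite distance; [u] may be the point at infinity. *)
Lemma reduced_lipschitz x y u : (rho x y < +oo)%E -> `|d x u - d y u| <= d x y.
Proof.
case: (dist_cases x y) => [->|[xy WW ->]|[xy nx ny] _].
- by rewrite subrr normr0 reduced_self.
- by rewrite ltxx.
have [Wu|nu] := pselect (W u).
  rewrite !(@reduced_infty _ u) ?subrr ?normr0 ?reduced_ge0//; try by right.
  + by move=> yu; apply: ny; rewrite yu.
  + by move=> xu; apply: nx; rewrite xu.
have h1 := reduced_triangle nx ny nu.
have h2 := reduced_triangle ny nx nu; rewrite (reducedC y x) in h2.
by rewrite ler_norml; apply/andP; split; lra.
Qed.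

Lemma metric_quasi_metric : possibly_extended quasi_metric_on rho.
Proof.
suff q D : metric_on D rho -> quasi_metric_on D rho.
  by case: hrho => [/q|[w [Ww /q]]]; [left|right; exists w].
move=> [s t]; split=> //; exists 2 => [|x y z Dx Dy Dz]; first by rewrite ler1n.
apply: (le_trans (t _ _ _ Dx Dy Dz)).
have [+ _ _ _] := s _ _ Dy Dz; have [+ _ _ _] := s _ _ Dx Dy.
case: (rho x y) => [a| |]// _; case: (rho y z) => [b| |]// _.
rewrite -EFin_max -EFinM -EFinD lee_fin.
by have := lexx (Num.max a b); rewrite {1}ge_max => /andP[]; lra.
Qed.

(** * The Moebius structure in terms of the reduced distance *)

Lemma cross_ratioE z1 z2 z3 z4 : z1 <> z3 -> z2 <> z4 ->
  cross_ratio rho z1 z2 z3 z4 = (d z1 z2 * d z3 z4 / (d z1 z3 * d z2 z4))%:E.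
Proof.
move=> /reduced_gt0 h13 /reduced_gt0 h24.
by rewrite /cross_ratio !cancel_dist inver mulf_eq0 !gt_eqF.
Qed.

Lemma cross_ratio_oo z1 z2 z3 z4 : z1 <> z2 -> z3 <> z4 ->
  z1 = z3 \/ z2 = z4 -> cross_ratio rho z1 z2 z3 z4 = +oo%E.
Proof.
move=> /reduced_gt0 h12 /reduced_gt0 h34 e; rewrite /cross_ratio !cancel_dist.
have -> : ((d z1 z3)%:E * (d z2 z4)%:E = 0 :> \bar R)%E.
  by case: e => ->; rewrite reduced_self ?mul0e ?mule0.
by rewrite inve0 gt0_muley// -EFinM lte_fin mulr_gt0.
Qed.

Context (M : mobius_structure R Z) (hM : induces rho M).

Lemma mobius_c_lt x x' y z r : x <> y -> x' <> z ->
  (mobius_c M x x' y z < (- r)%:E)%E =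
  (d x x' * d y z < expR (- r) * (d x y * d x' z)).
Proof.
move=> xy xz.
have adm : admissible x x' y z by apply: admissible_pairs; apply: Or32.
rewrite /mobius_c hM// /= cross_ratioE// lne_lt_EFin.
  by rewrite ltr_pdivrMr// mulr_gt0// reduced_gt0.
by rewrite divr_ge0// mulr_ge0// reduced_ge0.
Qed.

(** The distance [rho_A] is the inversion of [d] at [w], rescaled: both formulas
    that define it reduce to the same quotient. *)
Lemma mobius_distE w al be x y : w <> al -> w <> be -> al <> be ->
  x <> w -> y <> w ->
  mobius_dist M w al be x y =
  (d al w * d be w / d al be * d x y / (d x w * d y w))%:E.
Proof.
move=> wal wbe albe xw yw.
have [yw0 xw0] := (reduced_gt0 yw, reduced_gt0 xw).
have [alw0 bew0] := (reduced_gt0 wal, reduced_gt0 wbe).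
rewrite reducedC in alw0; rewrite reducedC in bew0.
have albe0 := reduced_gt0 albe.
rewrite /mobius_dist; have [->|/eqP xy] := eqVneq x y.
  by rewrite reduced_self mulr0 mul0r.
have xy0 := reduced_gt0 xy.
have pairs z1 z2 z3 z4 : z1 <> z4 -> z2 <> z3 -> admissible z1 z2 z3 z4.
  by move=> *; apply: admissible_pairs; apply: Or33.
have [/andP[/eqP xbe /eqP yal]|nxy] := boolP ((x != be) && (y != al)).
  have [xbe0 yal0] := (reduced_gt0 xbe, reduced_gt0 yal).
  rewrite /mobius_a !hM; try exact/pairs/nesym; try exact: pairs.
  rewrite /= !cross_ratioE//; try exact: nesym.
  rewrite !(reducedC al y) !(reducedC be x) !(reducedC w x) !(reducedC y x).
  rewrite expeR_lneDB ?divr_gt0 ?mulr_gt0//.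
  by congr (_%:E); field; rewrite !gt_eqF.
have [xal ybe] : x <> al /\ y <> be.
  by move: nxy; rewrite negb_and !negbK => /orP[] /eqP e; subst;
    split=> // e; subst.
have [xal0 ybe0] := (reduced_gt0 xal, reduced_gt0 ybe).
rewrite /mobius_b !hM; try exact/pairs/nesym; try exact: pairs.
rewrite /= !cross_ratioE//; try exact: nesym.
rewrite !(reducedC al x) !(reducedC be y) !(reducedC be w) !(reducedC w y).
rewrite (reducedC w be) expeR_lneBB ?divr_gt0 ?mulr_gt0//.
by congr (_%:E); field; rewrite !gt_eqF.
Qed.

(** At [x = w] the infinite value comes from [a(al, w, w, be) = +oo] in the first
    formula and from [b(al, w, w, be) = -oo] in the second one. *)
Lemma mobius_dist_oo w al be y : w <> al -> w <> be -> al <> be -> y <> w ->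
  mobius_dist M w al be w y = +oo%E.
Proof.
move=> wal wbe albe yw.
have pairs z1 z2 z3 z4 : z1 <> z4 -> z2 <> z3 -> admissible z1 z2 z3 z4.
  by move=> *; apply: admissible_pairs; apply: Or33.
have adm : admissible al w w be.
  by apply: admissible_pairs; apply: Or31; split=> //; exact: nesym.
rewrite /mobius_dist eq_sym; have /eqP/negbTE -> := yw.
have /eqP -> := wbe => /=.
have [/eqP yal|yal] := boolP (y != al).
  rewrite /mobius_a !hM//; try exact/pairs/nesym; try exact: pairs.
  rewrite /= (@cross_ratio_oo al w be w)//; try by [right|apply: nesym].
  rewrite !cross_ratioE//; try exact: nesym.
  have num0 z1 z2 z3 z4 z5 z6 z7 z8 : z1 <> z2 -> z3 <> z4 -> z5 <> z6 ->
      z7 <> z8 -> 0 < d z1 z2 * d z3 z4 / (d z5 z6 * d z7 z8).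
    by move=> *; rewrite divr_gt0// mulr_gt0// reduced_gt0.
  by rewrite !lne_EFin//; apply: num0 => //; exact: nesym.
move: yal; rewrite negbK => /eqP ->.
rewrite /mobius_b !hM//; try exact/pairs/nesym; try exact: pairs.
rewrite /= !cross_ratioE//; try exact: nesym.
rewrite reduced_self mulr0 mul0r (le0_lneNy (lexx 0%E)).
have num0 : 0 < d al be * d w al / (d al w * d be al).
  by rewrite divr_gt0// mulr_gt0// reduced_gt0//; exact: nesym.
by rewrite lne_EFin.
Qed.

(** With the denominators cleared, the description also covers [x = w], where
    both sides are false, and [x = y], where both are true. *)
Lemma mobius_dist_lt w al be x y r : uniq [:: w; al; be] -> y <> w -> 0 < r ->
  (mobius_dist M w al be x y < r%:E)%E =
  (d al w * d be w / d al be * d x y < r * (d x w * d y w)).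
Proof.
rewrite /= !inE negb_or !andbT => /andP[/andP[/eqP wal /eqP wbe] /eqP albe].
move=> yw r0; have [->|/eqP xw] := eqVneq x w.
  rewrite mobius_dist_oo// reduced_self mul0r mulr0.
  transitivity false; first by rewrite ltNge leey.
  apply/esym/negbTE; rewrite -leNgt.
  by rewrite !mulr_ge0 ?invr_ge0 ?reduced_ge0.
by rewrite mobius_distE// lte_fin ltr_pdivrMr// mulr_gt0// reduced_gt0.
Qed.
End reduced.

(** * Convergence in the Moebius topology *)

Lemma mobius_cvgP (R : realType) (Z : choiceType) (M : mobius_structure R Z)
    (x : nat -> mobius_space M) (z : mobius_space M) :
  x n @[n --> \oo] --> z <->
  (forall B : set Z, mobius_subbase M B -> B z -> \forall n \near \oo, B (x n)).
Proof.
split=> [xz B MB Bz|xz A].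
  apply: (xz B); rewrite nbhsE; exists B => //; split=> //.
  exists [set B]; last by rewrite bigcup_set1.
  by move=> _ ->; exact: finI_from1.
rewrite nbhsE => - [_ [[B sB <-] [C BC Cz]] sBA].
apply: filterS sBA _; apply: (@filterS _ _ _ C); first by move=> ? ?; exists C.
have /sB [D sD IDeC] := BC; rewrite -IDeC; apply: filter_bigI => E DE.
have := sD _ DE; rewrite inE => ME.
by apply: xz => //; move: Cz; rewrite -IDeC => /(_ _ DE).
Qed.

Section convergence.
Context {R : realType} {Z : choiceType} (rho : Z -> Z -> \bar R).
Context (hrho : possibly_extended metric_on rho).
Context (M : mobius_structure R Z) (hM : induces rho M).
Local Notation d := (reduced_dist rho).

(** Uses the subbasic ball around [w] for the triple [(w', w, v)]. *)
Lemma mobius_cvg_lt (x : nat -> mobius_space M) (w w' v : Z) (e : R) :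
  x n @[n --> \oo] --> (w : mobius_space M) ->
  w <> w' -> v <> w -> v <> w' -> 0 < e ->
  \forall n \near \oo, d (x n) w < e * d (x n) w'.
Proof.
move=> xw ww' vw vw' e0.
have u : uniq [:: w'; w; v].
  by rewrite /= !inE negb_or !andbT; apply/andP; split; [apply/andP; split|];
    apply/eqP => // /esym.
have ww0 := reduced_gt0 hrho ww'.
pose k := d w w' * d v w' / d w v.
have k0 : 0 < k by rewrite divr_gt0 ?mulr_gt0 ?reduced_gt0//; exact: nesym.
have r0 : 0 < e * k / d w w' by rewrite divr_gt0// mulr_gt0.
(* With this radius the ball is [k * d x w < k * (e * d x w')]. *)
have B : mobius_subbase M
    [set x | (mobius_dist M w' w v x w < (e * k / d w w')%:E)%E].
  by exists w', w, v, (e * k / d w w'), w; split.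
have := (mobius_cvgP _ _).1 xw _ B.
rewrite /= {1}/mobius_dist eqxx lte_fin => /(_ r0).
apply: filterS => n; rewrite (mobius_dist_lt hrho hM)//.
rewrite -/k (_ : _ * (_ * _) = k * (e * d (x n) w')); first by rewrite ltr_pM2l.
by field; rewrite gt_eqF.
Qed.

(** The inequality [k * d x y < c * d x w'] that defines a subbasic ball is
    homogeneous in [d x], so it is enough that [d (x n)], divided by a positive
    normalization [s n], converges pointwise to [d w]. The normalization is what
    allows [w] to be the point at infinity. *)
Lemma mobius_cvg_scaled (x : nat -> mobius_space M) (w : Z) (s : nat -> R) :
  (forall (u : Z) (e : R), 0 < e -> \forall n \near \oo,
    0 < s n /\ `|d (x n) u - s n * d w u| <= e * s n) ->
  x n @[n --> \oo] --> (w : mobius_space M).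
Proof.
move=> H; apply/mobius_cvgP => B [w' [al [be [r [y [u r0 yw' ->]]]]]] /=.
rewrite (mobius_dist_lt hrho hM)//.
set k := _ / _; set c := r * d y w'.
have k0 : 0 <= k by rewrite !mulr_ge0 ?invr_ge0 ?reduced_ge0.
have c0 : 0 < c by rewrite mulr_gt0// reduced_gt0.
rewrite (_ : r * _ = c * d w w'); last by rewrite /c; ring.
move=> wB.
(* The errors in [d x y] and [d x w'] use up half of the gap at [w]. *)
pose e := (c * d w w' - k * d w y) / (k + c) / 2.
have kc0 : 0 < k + c by rewrite ltr_wpDl.
have e0 : 0 < e by rewrite !divr_gt0// subr_gt0.
have eE : c * d w w' - k * d w y = 2 * e * (k + c).
  by rewrite /e; field; rewrite gt_eqF.
clearbody e; near=> n.
have [s0 h1] : 0 < s n /\ `|d (x n) y - s n * d w y| <= e * s n.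
  by near: n; exact: H.
have [_ h2] : 0 < s n /\ `|d (x n) w' - s n * d w w'| <= e * s n.
  by near: n; exact: H.
rewrite /= (mobius_dist_lt hrho hM)// -/k.
rewrite (_ : r * _ = c * d (x n) w'); last by rewrite /c; ring.
move: h1 h2; rewrite !ler_norml => /andP[_ h1] /andP[h2 _].
have {}h1 : k * (d (x n) y - s n * d w y) <= k * (e * s n) by rewrite ler_wpM2l.
have {}h2 : c * (- (e * s n)) <= c * (d (x n) w' - s n * d w w').
  by rewrite ler_wpM2l// ltW.
have h3 : 0 < s n * e * (k + c) by rewrite !mulr_gt0.
have h4 : s n * (c * d w w' - k * d w y) = s n * (2 * e * (k + c)).
  by rewrite eE.
nra.
Unshelve. all: by end_near. Qed.

End convergence.

(** * Cauchy sequences in terms of the reduced distance *)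

Section completeness.
Context {R : realType} {Z : choiceType} (rho : Z -> Z -> \bar R).
Context (hrho : possibly_extended metric_on rho).
Local Notation d := (reduced_dist rho).
Local Notation W := (is_infinity rho).

(** The condition [c(x n, x m, y, z) --> -oo], stated in terms of [d]:
    [d (x n) (x m) = o(d (x n) y * d (x m) z)]. The constant factor [d y z] is
    absorbed in [e], and [x n <> y], [x m <> z] are the part of admissibility
    that matters. *)
Definition cross_cauchy (x : nat -> Z) (y z : Z) :=
  forall e : R, 0 < e -> exists N, forall n m, (N <= n)%N -> (N <= m)%N ->
    [/\ x n <> y, x m <> z & d (x n) (x m) < e * (d (x n) y * d (x m) z)].

Lemma cross_cauchyC x y z : cross_cauchy x y z -> cross_cauchy x z y.
Proof.
move=> H e e0; have [N HN] := H e e0; exists N => n m Nn Nm.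
have [? ? ?] := HN m n Nm Nn; split=> //.
by rewrite reducedC// [X in _ * X]mulrC.
Qed.

Section mobius.
Context (M : mobius_structure R Z) (hM : induces rho M).

(** Cross ratios do not depend on the quasi-metric of the definition, so they may
    be computed with [rho]. Admissibility of the quadruple for [n = m] gives
    [x n <> y] and [x n <> z]. *)
Lemma mobius_cauchy_cross (x : nat -> Z) : mobius_cauchy M x ->
  exists y z, y <> z /\ cross_cauchy x y z.
Proof.
move=> [sigma [_ _ [y [z [[yz _ _ _ _] H]]]]]; exists y, z; split=> // e e0.
have yz0 := reduced_gt0 hrho yz.
have [N HN] := H (- ln (e * d y z)); exists N => n m Nn Nm.
have [+ _] := HN n n Nn Nn; rewrite /admissible !eqxx => /and4P[/eqP xy _ _ _].
have [+ _] := HN m m Nm Nm; rewrite /admissible !eqxx => /and4P[_ /eqP xz _ _].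
split=> //; have [_] := HN n m Nn Nm.
rewrite (mobius_c_lt hrho hM)// opprK lnK ?posrE ?mulr_gt0//.
by rewrite mulrAC ltr_pM2r.
Qed.

Lemma cross_mobius_cauchy (x : nat -> Z) y z : y <> z -> ~ W y -> ~ W z ->
  ~ (rho (x n) y @[n --> \oo] --> (0 : \bar R)) ->
  ~ (rho (x n) z @[n --> \oo] --> (0 : \bar R)) ->
  cross_cauchy x y z -> mobius_cauchy M x.
Proof.
move=> yz ny nz xy xz H; have yz0 := reduced_gt0 hrho yz.
exists rho; split=> //; first exact: metric_quasi_metric.
exists y, z; split=> // r.
have [|N HN] := H (expR (- r) / d y z); first by rewrite divr_gt0// expR_gt0.
exists N => n m Nn Nm; have [xny xmz h] := HN n m Nn Nm; split.
  by apply: admissible_pairs; apply: Or32.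
by rewrite (mobius_c_lt hrho hM)// -ltr_pdivlMr// mulrAC.
Qed.

End mobius.

(** If the sequence does not escape to infinity, some finite [x n] with large [n]
    has [d (x n) z <= B]. The estimate and the triangle inequality then give
    [d (x m) z <= B + d (x m) z / 2], so that the factors on the right of the
    estimate are bounded. *)
Lemma cross_cauchy_dichotomy x y z : y <> z -> ~ W z -> cross_cauchy x y z ->
  (forall e : R, 0 < e -> exists N, forall n m, (N <= n)%N -> (N <= m)%N ->
    d (x n) (x m) < e) \/
  (forall B : R, exists N, forall n, (N <= n)%N -> W (x n) \/ B < d (x n) z).
Proof.
move=> yz nz H.
have [?|/existsNP[B HB]] := pselect (forall B : R, exists N, forall n,
  (N <= n)%N -> W (x n) \/ B < d (x n) z); [by right|left].
have {}HB N : exists n, [/\ (N <= n)%N, ~ W (x n) & d (x n) z <= B].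
  apply: contrapT => nH; apply: HB; exists N => n Nn.
  apply: contrapT => /not_orP[nW /negP]; rewrite -leNgt => xB.
  by apply: nH; exists n.
have B0 : 0 <= B.
  by have [n [_ _ /(le_trans (reduced_ge0 hrho _ _))]] := HB 0%N.
(* The summand 1 covers the case in which [a] or [y] is at infinity. *)
pose D := d y z + 1.
have D1 : 1 <= D by rewrite lerDr reduced_ge0.
have pqD a : a <> y -> d a y <= d a z + D.
  move=> ay; have [WW|/not_orP[na ny]] := pselect (W a \/ W y).
    by rewrite reduced_infty//; have := reduced_ge0 hrho a z; lra.
  have := reduced_triangle hrho na nz ny.
  by rewrite (reducedC hrho z y) /D; lra.
have BD : 0 < B + D by lra.
have BD0 : 0 < 2 * (B + D) by rewrite mulr_gt0.
have [|N HN] := H (1 / (2 * (B + D))); first by rewrite divr_gt0.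
have [n [Nn nW nB]] := HB N.
pose C := 2 * B + 1.
have qC m : (N <= m)%N -> d (x m) z <= C.
  move=> Nm; have [xny xmz h] := HN n m Nn Nm.
  have [Wm|nm] := pselect (W (x m)).
    by rewrite reduced_infty//; [rewrite /C; lra|left].
  have t := reduced_triangle hrho nm nW nz.
  rewrite (reducedC hrho (x m) (x n)) in t.
  have qm0 := reduced_ge0 hrho (x m) z.
  have : 1 / (2 * (B + D)) * (d (x n) y * d (x m) z) <= d (x m) z / 2.
    have : d (x n) y * d (x m) z <= (B + D) * d (x m) z.
      by rewrite ler_wpM2r//; have := pqD _ xny; lra.
    move=> /(ler_wpM2l (ltW (divr_gt0 ltr01 BD0))) /le_trans; apply.
    by rewrite le_eqVlt; apply/orP; left; apply/eqP; field; rewrite gt_eqF.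
  by rewrite /C; lra.
have C0 : 0 < C by rewrite /C; lra.
have CD0 : 0 < (C + D) * C by rewrite mulr_gt0//; lra.
move=> e e0; have [|N' HN'] := H (e / ((C + D) * C)); first by rewrite divr_gt0.
exists (maxn N N') => i j; rewrite !geq_max => /andP[Ni N'i] /andP[Nj N'j].
have [xiy xjz /lt_le_trans] := HN' i j N'i N'j; apply.
rewrite mulrAC ler_pdivrMr// ler_wpM2l//; first exact: ltW.
apply: ler_pM; rewrite ?reduced_ge0//; last exact: qC.
by have := pqD _ xiy; have := qC i Ni; lra.
Qed.

End completeness.

(** * Completeness of the metric implies completeness of the Moebius space *)

Section complete_mobius.
Context {R : realType} {Z : choiceType} (rho : Z -> Z -> \bar R).
Context (hrho : possibly_extended metric_on rho).
Context (M : mobius_structure R Z) (hM : induces rho M).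
Local Notation d := (reduced_dist rho).
Local Notation W := (is_infinity rho).

Lemma cvg_mobius_cvg (x : nat -> mobius_space M) (w : Z) :
  rho (x n) w @[n --> \oo] --> (0 : \bar R) ->
  x n @[n --> \oo] --> (w : mobius_space M).
Proof.
move=> /(cvge0P (fun n => dist_ge0 hrho _ _)) xw.
apply: (mobius_cvg_scaled hrho hM (s := fun=> 1)) => u e e0.
apply: filterS (xw e e0) => n xne; split=> //; rewrite mul1r mulr1.
have fin : (rho (x n) w < +oo)%E by apply: lt_le_trans xne (leey _).
apply: le_trans (reduced_lipschitz hrho u fin) _.
by move: xne; rewrite (dist_fin hrho fin) lte_fin => /ltW.
Qed.

Lemma mobius_cvg_infinity (x : nat -> mobius_space M) (w o : Z) :
  W w -> ~ W o ->
  (forall B : R, exists N, forall n, (N <= n)%N -> W (x n) \/ B < d (x n) o) ->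
  x n @[n --> \oo] --> (w : mobius_space M).
Proof.
move=> Ww no xoo.
have near_oo (B : R) : \forall n \near \oo,
    x n = w \/ x n <> w /\ B < d (x n) o.
  have [N HN] := xoo B; exists N => // n /= /HN h.
  have [->|/eqP nw] := eqVneq (x n) w; [by left|right; split=> //].
  by case: h => // Wx; case: nw; exact: infinity_unique hrho _ _ Wx Ww.
apply: (mobius_cvg_scaled hrho hM
  (s := fun n => if x n == w then 1 else d (x n) o)) => u e e0.
have [->{u}|/eqP uw] := eqVneq u w.
  apply: filterS (near_oo (1 / e)) => n -[->|[/[dup] nw /eqP/negbTE -> h]].
    rewrite eqxx reduced_self// mulr0 subr0 normr0 mulr1.
    by split=> //; exact: ltW.
  have e1 : 0 < 1 / e by rewrite divr_gt0.
  rewrite reduced_self// mulr0 subr0 (@reduced_infty _ _ _ _ w)//; last by right.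
  by split; [exact: lt_trans h|rewrite normr1 mulrC -ler_pdivrMr// ltW].
have nu : ~ W u by move=> Wu; apply: uw; exact: infinity_unique hrho _ _ Wu Ww.
apply: filterS (near_oo (d u o / e)) => n -[->|[/[dup] nw /eqP/negbTE -> h]].
  by rewrite eqxx mul1r subrr normr0 mulr1; split=> //; exact: ltW.
have q0 : 0 < d (x n) o.
  by apply: le_lt_trans h; rewrite divr_ge0 ?reduced_ge0// ltW.
split=> //; rewrite (@reduced_infty _ _ _ w u); [|by left|exact: nesym].
have fin : (rho u o < +oo)%E by rewrite (dist_off_infinity hrho nu no) ltry.
rewrite mulr1 (reducedC hrho _ u) (reducedC hrho _ o).
apply: le_trans (reduced_lipschitz hrho _ fin) _.
by rewrite (reducedC hrho o) mulrC -ler_pdivrMr// ltW.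
Qed.

Lemma bounded_not_unbounded x o : bounded_distance rho -> ~ W o ->
  ~ (forall B : R, exists N : nat, forall n : nat, (N <= n)%N ->
      W (x n) \/ B < d (x n) o).
Proof.
rewrite /bounded_distance => bd no xoo.
set S := ereal_sup _ in bd.
have leS a b : (rho a b <= S)%E by apply: ereal_sup_ubound; exists (a, b).
have Sfin : S \is a fin_num.
  by rewrite ge0_fin_numE//; apply: le_trans (leS o o); exact: dist_ge0.
have [N HN] := xoo (fine S).
have fin := le_lt_trans (leS (x N) o) bd.
case: (HN N (leqnn N)) => [Wx|].
  have xo : x N <> o by move=> xo; apply: no; rewrite -xo.
  by move: fin; rewrite (dist_infty (or_introl Wx) xo) ltxx.
apply/negP; rewrite -leNgt -lee_fin (fineK Sfin).
by rewrite -(dist_fin hrho fin) leS.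
Qed.

Lemma complete_mobius_complete : metric_complete rho ->
  bounded_distance rho \/ has_infinity rho -> mobius_complete M.
Proof.
move=> cpl bd x /(mobius_cauchy_cross hrho hM)[y [z [yz xyz]]].
have [p [np dich]] : exists p, ~ W p /\
  ((forall e : R, 0 < e -> exists N, forall n m, (N <= n)%N -> (N <= m)%N ->
    d (x n) (x m) < e) \/
  (forall B : R, exists N, forall n, (N <= n)%N -> W (x n) \/ B < d (x n) p)).
  have [Wz|nz] := pselect (W z); last first.
    by exists z; split=> //; exact: cross_cauchy_dichotomy yz nz xyz.
  have ny : ~ W y.
    by move=> Wy; apply: yz; exact: infinity_unique hrho _ _ Wy Wz.
  exists y; split=> //; apply: (cross_cauchy_dichotomy hrho (nesym yz) ny).
  exact: cross_cauchyC.
case: dich => [xc|xoo].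
  have [|w xw] := cpl x; last by exists w; exact: cvg_mobius_cvg.
  (* Where [d] is less than 1, it agrees with [rho]. *)
  move=> e e0; have [|N HN] := xc (Num.min e 1).
    by rewrite lt_min e0 ltr01.
  exists N => n m Nn Nm; have := HN n m Nn Nm; rewrite lt_min => /andP[xe x1].
  by rewrite reduced_lt_dist.
case: bd => [bd|[w Ww]]; first by case: (bounded_not_unbounded bd np xoo).
by exists w; exact: mobius_cvg_infinity Ww np xoo.
Qed.

End complete_mobius.

(** * Completeness of the Moebius space implies completeness of the metric *)

Lemma third_point (Z : choiceType) :
  (exists x y z : Z, [/\ x <> y, y <> z & x <> z]) ->
  forall a b : Z, exists c, c <> a /\ c <> b.
Proof.
move=> [x [y [z [xy yz xz]]]] a b.
have [xa|/eqP xa] := eqVneq x a.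
  have [yb|/eqP yb] := eqVneq y b; last first.
    by exists y; split=> // ya; apply: xy; subst.
  by exists z; split=> ?; subst.
have [xb|/eqP xb] := eqVneq x b; last by exists x.
have [ya|/eqP ya] := eqVneq y a; first by exists z; split=> ?; subst.
by exists y; split=> // ?; subst.
Qed.

Section mobius_complete.
Context {R : realType} {Z : choiceType} (rho : Z -> Z -> \bar R).
Context (hrho : possibly_extended metric_on rho).
Context (hZ : exists x y z : Z, [/\ x <> y, y <> z & x <> z]).
Local Notation d := (reduced_dist rho).
Local Notation W := (is_infinity rho).

Lemma two_points_off_infinity : exists y z, [/\ y <> z, ~ W y & ~ W z].
Proof.
have [a _] := hZ.
(* [w] is the point at infinity if there is one, and arbitrary otherwise. *)
have [w [y [z [wy wz yz nW]]]] : exists w y z : Z,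
    [/\ w <> y, w <> z, y <> z & forall v, W v -> v = w].
  have [w Ww] : exists w, forall v, W v -> v = w.
    have [[w Ww]|nW] := pselect (exists w, W w).
      by exists w => v Wv; exact: infinity_unique hrho _ _ Wv Ww.
    by exists a => v Wv; case: nW; exists v.
  have [y [yw _]] := third_point hZ w w.
  have [z [zw zy]] := third_point hZ w y.
  by exists w, y, z; split=> //; exact: nesym.
by exists y, z; split=> // /nW; exact: nesym.
Qed.

(** The sequence tends to infinity relative to every base point [u], not only
    relative to the one used to construct it. *)
Lemma unbounded_escape : ~ has_infinity rho -> ~ bounded_distance rho ->
  exists x : nat -> Z, forall u B, exists N, forall n, (N <= n)%N ->
    B < d (x n) u.
Proof.
move=> nW nb.
have off v : ~ W v by move=> Wv; apply: nW; exists v.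
have [p _] := hZ.
have far B : exists a, B < d a p.
  apply: contrapT => H; apply: nb; rewrite /bounded_distance.
  have le_B a : d a p <= B.
    by rewrite leNgt; apply/negP => ?; apply: H; exists a.
  apply: (@le_lt_trans _ _ (2 * B)%:E); last by rewrite ltry.
  apply: ge_ereal_sup => _ [[a b] _ <-] /=.
  rewrite (dist_off_infinity hrho)// lee_fin.
  have := reduced_triangle hrho (off a) (off p) (off b).
  by rewrite (reducedC hrho p); have := le_B a; have := le_B b; lra.
have [x hx] := choice (fun n : nat => far n%:R).
exists x => u B; have [N hN] : exists N : nat, B + d u p <= N%:R.
  exists (Num.truncn (B + d u p)).+1; apply: ltW; exact: truncnS_gt.
exists N => n Nn.
have := reduced_triangle hrho (off (x n)) (off u) (off p).
have Nn' : N%:R <= n%:R :> R by rewrite ler_nat.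
by have := hx n; lra.
Qed.

(** For [p = d (x n) y] and [q = d (x m) z] the triangle inequality bounds
    [d (x n) (x m)] by [p + q + d y z], which is negligible against [p * q]. *)
Lemma escape_cross_cauchy x y z : ~ W y -> ~ W z -> (forall n, ~ W (x n)) ->
  (forall u B, exists N, forall n, (N <= n)%N -> B < d (x n) u) ->
  cross_cauchy rho x y z.
Proof.
move=> ny nz nx xoo e e0; pose D := d y z.
have D0 : 0 <= D by exact: reduced_ge0.
(* Beyond [K], each of [p], [q] and [D] is less than a third of
   [e * (p * q)]. *)
pose K := 3 / e + D + 1.
have e3 : 0 < 3 / e by rewrite divr_gt0.
have [Ny HNy] := xoo y K; have [Nz HNz] := xoo z K.
exists (maxn Ny Nz) => n m; rewrite !geq_max => /andP[Nyn _] /andP[_ Nzm].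
have {HNy}pn := HNy n Nyn; have {HNz}qm := HNz m Nzm.
split.
- by move=> E; move: pn; rewrite E reduced_self// /K; lra.
- by move=> E; move: qm; rewrite E reduced_self// /K; lra.
have h1 := reduced_triangle hrho (nx n) ny (nx m).
have h2 := reduced_triangle hrho (nx m) nz ny.
rewrite (reducedC hrho y) in h1; rewrite (reducedC hrho z) -/D in h2.
set p := d (x n) y in pn h1 *; set q := d (x m) z in qm h2 *.
have pe : 3 < e * p by rewrite mulrC -ltr_pdivrMr// /K in pn *; lra.
have qe : 3 < e * q by rewrite mulrC -ltr_pdivrMr// /K in qm *; lra.
have p0 : 0 < p by move: pn; rewrite /K; lra.
have q0 : 0 < q by move: qm; rewrite /K; lra.
have hp : 3 * p < e * q * p by rewrite ltr_pM2r.
have hq : 3 * q < e * p * q by rewrite ltr_pM2r.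
have Dp : D < p by move: pn; rewrite /K; lra.
have -> : e * (p * q) = (e * q * p + e * p * q) / 2 by field.
lra.
Qed.

Section cauchy_without_limit.
Context (u : nat -> Z) (uc : metric_cauchy rho u).
Context (nlim : ~ exists z, rho (u n) z @[n --> \oo] --> (0 : \bar R)).

(** A Cauchy sequence that visits the point at infinity at late times is
    eventually constant. *)
Lemma no_limit_off_infinity : exists N, forall n m, (N <= n)%N -> (N <= m)%N ->
  ~ W (u n) /\ d (u n) (u m) < 1.
Proof.
have [N HN] := uc ltr01; exists N => n m Nn Nm.
have fin i j : (N <= i)%N -> (N <= j)%N -> (rho (u i) (u j) < +oo)%E.
  by move=> Ni Nj; apply: lt_le_trans (HN i j Ni Nj) (leey _).
split=> [Wn|]; last first.
  by have := HN n m Nn Nm; rewrite (dist_fin hrho (fin _ _ Nn Nm)) lte_fin.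
apply: nlim; exists (u n); apply/cvge0P => [k|e e0]; first exact: dist_ge0.
exists N => // k /= Nk.
case: (@dist_cases _ _ rho (u k) (u n)) => [->|[_ _ E]|[]//].
  by rewrite (dist_self hrho) lte_fin.
by have := fin _ _ Nk Nn; rewrite E ltxx.
Qed.

(** For a finite point [y], a subsequence at distance at least [e] from [y] keeps
    the whole tail at distance at least [e / 2]. At the point at infinity the
    reduced distance is eventually 1. *)
Lemma no_limit_lower y : exists2 e : R, 0 < e &
  exists N, forall n, (N <= n)%N -> e <= d (u n) y.
Proof.
have [N0 HN0] := no_limit_off_infinity.
have [Wy|ny] := pselect (W y).
  exists 1 => //; exists N0 => n Nn; have [nu _] := HN0 n n Nn Nn.
  by rewrite reduced_infty//; [right|move=> E; apply: nu; rewrite E].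
have /(cvge0P (fun n => dist_ge0 hrho _ _)) :
    ~ (rho (u n) y @[n --> \oo] --> (0 : \bar R)).
  by move=> uy; apply: nlim; exists y.
move=> /existsNP[e /not_implyP[e0 He]].
exists (e / 2); first by rewrite divr_gt0.
have [|N HN] := uc (e := Num.min (e / 2) 1); first by rewrite lt_min divr_gt0/=.
have [n Nn le_e] : exists2 n, (maxn N N0 <= n)%N & e <= d (u n) y.
  apply: contrapT => H; apply: He; exists (maxn N N0) => // n /= Nn.
  have N0n := leq_trans (leq_maxr _ _) Nn.
  have [nu _] := HN0 n n N0n N0n.
  rewrite (dist_off_infinity hrho nu ny) lte_fin ltNge; apply/negP => ?.
  by apply: H; exists n.
move: Nn; rewrite geq_max => /andP[Nn N0n].
exists (maxn N N0) => m; rewrite geq_max => /andP[Nm N0m].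
have [nn _] := HN0 n m N0n N0m; have [nm _] := HN0 m n N0m N0n.
have := HN n m Nn Nm; rewrite (dist_off_infinity hrho nn nm) lte_fin lt_min.
move=> /andP[h _]; have := reduced_triangle hrho nn nm ny; lra.
Qed.

Lemma no_limit_upper y : exists2 B : R, 0 < B &
  exists N, forall n, (N <= n)%N -> d (u n) y <= B.
Proof.
have [N HN] := no_limit_off_infinity.
have [Wy|ny] := pselect (W y).
  exists 1 => //; exists N => n Nn; have [nu _] := HN n n Nn Nn.
  by rewrite reduced_infty//; [right|move=> E; apply: nu; rewrite E].
exists (1 + d (u N) y); first by rewrite ltr_pwDl// reduced_ge0.
exists N => n Nn; have [nn h] := HN n N Nn (leqnn _).
have [nN _] := HN N N (leqnn _) (leqnn _).
by have := reduced_triangle hrho nn nN ny; lra.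
Qed.

Lemma no_limit_cross_cauchy y z : cross_cauchy rho u y z.
Proof.
move=> e e0.
have [a a0 [Na Ha]] := no_limit_lower y.
have [b b0 [Nb Hb]] := no_limit_lower z.
have [N0 HN0] := no_limit_off_infinity.
have [|N HN] := uc (e := e * (a * b)); first by rewrite !mulr_gt0.
exists (maxn (maxn N N0) (maxn Na Nb)) => n m; rewrite !geq_max.
move=> /andP[/andP[Nn N0n] /andP[Nan _]] /andP[/andP[Nm N0m] /andP[_ Nbm]].
have {}Ha := Ha n Nan; have {}Hb := Hb m Nbm; split.
- by move=> E; move: Ha; rewrite E (reduced_self hrho) leNgt a0.
- by move=> E; move: Hb; rewrite E (reduced_self hrho) leNgt b0.
have [nn _] := HN0 n m N0n N0m; have [nm _] := HN0 m n N0m N0n.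
have := HN n m Nn Nm; rewrite (dist_off_infinity hrho nn nm) lte_fin.
move=> /lt_le_trans; apply; rewrite ler_wpM2l//; first exact: ltW.
by apply: ler_pM => //; exact: ltW.
Qed.

End cauchy_without_limit.

Context (M : mobius_structure R Z) (hM : induces rho M).

Lemma mobius_complete_metric_complete :
  mobius_complete M -> metric_complete rho.
Proof.
move=> cpl u uc; apply: contrapT => nlim.
have [y [z [yz ny nz]]] := two_points_off_infinity.
have [|w uw] := cpl u.
  apply: (cross_mobius_cauchy hrho hM yz ny nz).
  - by move=> uy; apply: nlim; exists y.
  - by move=> uz; apply: nlim; exists z.
  exact: no_limit_cross_cauchy.
have [w' [w'w _]] := third_point hZ w w.
have [v [vw vw']] := third_point hZ w w'.
have [a a0 [Na Ha]] := no_limit_lower uc nlim w.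
have [B B0 [NB HB]] := no_limit_upper uc nlim w'.
have aB : 0 < a / B by rewrite divr_gt0.
have [N _ HN] := mobius_cvg_lt hrho hM uw (nesym w'w) vw vw' aB.
pose n := maxn N (maxn Na NB).
have h1 := HN n (leq_maxl _ _).
have h2 := Ha n (leq_trans (leq_maxl _ _) (leq_maxr _ _)).
have h3 := HB n (leq_trans (leq_maxr _ _) (leq_maxr _ _)).
have h4 : a / B * d (u n) w' <= a.
  by rewrite mulrAC ler_pdivrMr// ler_wpM2l// ltW.
by have := le_lt_trans h2 (lt_le_trans h1 h4); rewrite ltxx.
Qed.

Lemma mobius_complete_bounded : mobius_complete M ->
  bounded_distance rho \/ has_infinity rho.
Proof.
move=> cpl; apply: contrapT => /not_orP[nb ni].
have [x xoo] := unbounded_escape ni nb.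
have off v : ~ W v by move=> Wv; apply: ni; exists v.
have nlim v : ~ (rho (x n) v @[n --> \oo] --> (0 : \bar R)).
  move=> /(cvge0P (fun n => dist_ge0 hrho _ _)) /(_ 1 ltr01) [N _ HN].
  have [N' HN'] := xoo v 1.
  have := HN (maxn N N') (leq_maxl _ _); have := HN' (maxn N N') (leq_maxr _ _).
  rewrite /= (dist_off_infinity hrho)// lte_fin => /lt_trans h /h.
  by rewrite ltxx.
have [y [z [yz ny nz]]] := two_points_off_infinity.
have [|w xw] := cpl x.
  apply: (cross_mobius_cauchy hrho hM yz ny nz) => //.
  exact: escape_cross_cauchy.
have [w' [w'w _]] := third_point hZ w w.
have [v [vw vw']] := third_point hZ w w'.
have h2 : 0 < 1 / 2 :> R by rewrite divr_gt0.
have [N _ HN] := mobius_cvg_lt hrho hM xw (nesym w'w) vw vw' h2.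
have [N' HN'] := xoo w (d w w').
have := HN (maxn N N') (leq_maxl _ _); have := HN' (maxn N N') (leq_maxr _ _).
set n := maxn N N' => /= h3 h4.
have := reduced_triangle hrho (off (x n)) (off w) (off w').
by lra.
Qed.

End mobius_complete.

(** * The equivalence *)

Theorem theorem2 (R : realType) (Z : choiceType) (rho : Z -> Z -> \bar R)
    (M : mobius_structure R Z)
    (hrho : possibly_extended metric_on rho)
    (hZ : exists x y z : Z, [/\ x <> y, y <> z & x <> z])
    (hM : induces rho M) :
  mobius_complete M <->
  (metric_complete rho /\ (bounded_distance rho \/ has_infinity rho)).
Proof.
split=> [cpl|[cpl bd]]; last exact: (complete_mobius_complete hrho hM).
split; first exact: (mobius_complete_metric_complete hrho hZ hM).
exact: (mobius_complete_bounded hrho hZ hM).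
Qed.
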